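(* Let $m,n$ be positive integers with $n-1\le m\le\binom n2$, and let $G^{*}$ be the last graph in $S$-order over all graphs in $\mathscr{G}_{m,n}$. Then $G^{*}$ is isomorphic to the graph obtained from $K_{r_{m,n}}^{t_{m,n}}$ by adding $n-r_{m,n}-1$ pendant edges to a vertex of degree $r_{m,n}$.
   Context: Graphs are undirected, finite and simple. $\mathscr{G}_{m,n}$ is the set of connected graphs with $m$ edges and $n$ vertices. For a graph $G$ on $n$ vertices with adjacency eigenvalues $\lambda_1(G)\ge\cdots\ge\lambda_n(G)$, the $j$-th spectral moment is $S_j(G)=\sum_{i=1}^n\lambda_i(G)^j$, for $0\le j\le n-1$. For two graphs $G_1,G_2$ on $n$ vertices, write $G_1\prec_S G_2$ ($G_1$ comes before $G_2$ in $S$-order) if there is a positive integer $j\le n-1$ such that $S_i(G_1)=S_i(G_2)$ for all $i<j$ and $S_j(G_1)<S_j(G_2)$. The last graph in $S$-order over $\mathscr{G}_{m,n}$ is a graph $G^*\in\mathscr{G}_{m,n}$ such that $G\prec_S G^*$ for every $G\in\mathscr{G}_{m,n}$ not isomorphic to $G^*$. For positive integers $m,n$ with $n-1\le m\le\binom n2$, the positive integers $r_{m,n}$ and $t_{m,n}$ are defined by $$m-n=\binom{r_{m,n}-1}{2}+t_{m,n}-2,$$ where $2\le t_{m,n}\le r_{m,n}$ if $m-n\ge 0$, and $t_{m,n}=r_{m,n}=1$ if $m-n=-1$ (this determines them uniquely). For $0\le t\le r$, $K_r^t$ is the graph obtained from the complete graph $K_r$ by adding one new vertex and joining it to exactly $t$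 vertices of $K_r$. Adding a pendant edge to a vertex $v$ means adding a new vertex whose only neighbour is $v$. *)

(* Defs.v *)
From mathcomp Require Import all_boot all_order all_algebra all_field.
From mathcomp Require Import zify.

Set Implicit Arguments.
Unset Strict Implicit.
Unset Printing Implicit Defensive.

Import Order.TTheory GRing.Theory Num.Theory.
Local Open Scope ring_scope.

Record sgraph := SGraph {
  vertex :> finType;
  adj : rel vertex;
  adj_sym : symmetric adj;
  adj_irr : irreflexive adj }.

Definition edges (G : sgraph) : {set {set G}} :=
  [set [set u.1; u.2] | u : G * G & adj u.1 u.2].

Definition deg (G : sgraph) (v : G) : nat := #|[set w | adj v w]|.

(* Vacuously true of the graph without vertices, which the vertex count in
   [conn_graph] below excludes for positive n. *)
Definition connected (G : sgraph) : Prop :=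
  forall x y : G, connect (@adj G) x y.

Definition isomorphic (G H : sgraph) : Prop :=
  exists2 f : G -> H, bijective f & forall x y, adj (f x) (f y) = adj x y.

Definition conn_graph (m n : nat) (G : sgraph) : Prop :=
  [/\ connected G, #|edges G| = m & #|G| = n].

(* Eigenvalues with multiplicity, in nonincreasing order when they are all
   real (the order of algC is only partial); see [eigenvalues_real]. *)
Definition eigenvalues n (A : 'M[algC]_n) : seq algC :=
  sort >=%R (sval (closed_field_poly_normal (char_poly A))).

Lemma char_poly_eigenvalues n (A : 'M[algC]_n) :
  char_poly A = \prod_(x <- eigenvalues A) ('X - x%:P).
Proof.
rewrite /eigenvalues; case: closed_field_poly_normal => s /= Ds.
rewrite {1}Ds (monicP (char_poly_monic A)) scale1r.
by apply: perm_big; rewrite perm_sym perm_sort.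
Qed.

Lemma size_eigenvalues n (A : 'M[algC]_n) : size (eigenvalues A) = n.
Proof.
have := size_char_poly A.
by rewrite char_poly_eigenvalues size_prod_XsubC => -[].
Qed.

Definition adjmx (G : sgraph) : 'M[algC]_#|G| :=
  \matrix_(i, j) (adj (enum_val i) (enum_val j))%:R.

Lemma eigenvalues_real G : {in eigenvalues (adjmx G), forall x, x \is Num.real}.
Proof.
move=> x; rewrite -root_prod_XsubC -char_poly_eigenvalues -eigenvalue_root_char.
case/eigenvalueP=> v vA nz_v; pose w := (map_mx Num.conj v)^T.
have Aw : adjmx G *m w = x^* *: w.
  apply: trmx_inj; rewrite trmx_mul trmxK linearZ /= trmxK.
  rewrite -map_mxZ -vA map_mxM; congr (_ *m _).
  by apply/matrixP=> i j; rewrite !mxE /= conjC_nat adj_sym.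
have: x *: (v *m w) = x^* *: (v *m w).
  by rewrite [LHS]scalemxAl -vA -mulmxA Aw scalemxAr.
move/matrixP/(_ 0 0); rewrite mxE [RHS]mxE => eq_x.
suff nz : (v *m w) 0 0 != 0 by apply/CrealP; rewrite -(mulIf nz eq_x).
apply: contraNneq nz_v; rewrite mxE => /psumr_eq0P z.
apply/eqP/rowP=> i; rewrite mxE; apply/eqP.
rewrite -normr_eq0 -sqrf_eq0 normCK; apply/eqP.
rewrite -[RHS](z _ i) ?mxE // => j _.
by rewrite !mxE mul_conjC_ge0.
Qed.

Lemma eigenvalues_sorted G : sorted >=%R (eigenvalues (adjmx G)).
Proof.
apply: (sort_sorted_in (P := Num.real)).
  by move=> x y xR yR; exact: real_leVge.
by apply/allP=> x x_s; apply: (@eigenvalues_real G); rewrite mem_sort.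
Qed.

(* [lambda G i] is the i-th largest adjacency eigenvalue, counted from 0. *)
Definition lambda (G : sgraph) (i : nat) : algC := (eigenvalues (adjmx G))`_i.

Definition spectral_moment (j : nat) (G : sgraph) : algC :=
  \sum_(i < #|G|) lambda G i ^+ j.

(* Used for graphs G1, G2 on n vertices. *)
Definition S_prec (n : nat) (G1 G2 : sgraph) : Prop :=
  exists j : nat,
    [/\ (0 < j <= n.-1)%N,
        forall i, (i < j)%N -> spectral_moment i G1 = spectral_moment i G2
      & spectral_moment j G1 < spectral_moment j G2].

Definition last_in_S_order (m n : nat) (Gs : sgraph) : Prop :=
  conn_graph m n Gs /\
  forall G, conn_graph m n G -> ~ isomorphic G Gs -> S_prec n G Gs.

Definition is_rt (m n r t : nat) : Prop :=
  [/\ (0 < r)%N, (0 < t)%N,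
      m%:Z - n%:Z = 'C(r.-1, 2)%:Z + t%:Z - 2%:Z,
      0 <= m%:Z - n%:Z -> (2 <= t <= r)%N
    & m%:Z - n%:Z = -1 -> t = 1%N /\ r = 1%N].

Lemma is_rt_exists m n : (n <= m.+1)%N -> exists r t, is_rt m n r t.
Proof.
move=> le_nm; have [lt_mn | le_nm2] := ltnP m n.
  by exists 1%N, 1%N; split=> //=; rewrite ?bin_small //; lia.
have Hk k : exists r t, (2 <= t <= r)%N /\ k = ('C(r.-1, 2) + t - 2)%N.
  elim: k => [|k [r [t [/andP[t2 le_tr] Dk]]]]; first by exists 2%N, 2%N.
  have [le_rt | lt_tr] := leqP r t.
    exists r.+1, 2%N; split; first lia.
    have: 'C(r, 2) = ('C(r.-1, 2) + r.-1)%N.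
      by case: (r) t2 le_tr => [|r' _ _]; [lia | rewrite /= binS bin1].
    by rewrite /=; lia.
  by exists r, t.+1; split; lia.
have [r [t [t_r D]]] := Hk (m - n)%N.
by exists r, t; split; lia.
Qed.

Lemma is_rt_unique m n r t r' t' : (n <= m.+1)%N ->
  is_rt m n r t -> is_rt m n r' t' -> r = r' /\ t = t'.
Proof.
move=> le_nm [r0 t0 D ge0 eq1] [r0' t0' D' ge0' eq1'].
have [lt_mn | le_nm2] := ltnP m n.
  by have := eq1; have := eq1'; lia.
have {ge0}t_r : (2 <= t <= r)%N by apply: ge0; lia.
have {ge0'}t_r' : (2 <= t' <= r')%N by apply: ge0'; lia.
have binr s : (0 < s)%N -> 'C(s, 2) = ('C(s.-1, 2) + s.-1)%N.
  by case: s => // s _; rewrite /= binS bin1.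
have mono a b : (a <= b)%N -> ('C(a, 2) <= 'C(b, 2))%N by apply: leq_bin2l.
have := binr r r0; have := binr r' r0'.
have [lt_rr|lt_rr|eq_rr] := ltngtP r r'.
- by have := mono r r'.-1; lia.
- by have := mono r' r.-1; lia.
by subst r'; lia.
Qed.

Section AddVertex.
Variables (G : sgraph) (A : {set G}).

Definition add_vertex_adj : rel (option G) := fun x y =>
  match x, y with
  | Some u, Some v => adj u v
  | Some u, None | None, Some u => u \in A
  | None, None => false
  end.

Lemma add_vertex_sym : symmetric add_vertex_adj.
Proof. by move=> [u|] [v|] //=; rewrite adj_sym. Qed.

Lemma add_vertex_irr : irreflexive add_vertex_adj.
Proof. by move=> [u|] //=; rewrite adj_irr. Qed.

Definition add_vertex := SGraph add_vertex_sym add_vertex_irr.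
End AddVertex.

Section AddPendants.
Variables (G : sgraph) (v : G) (k : nat).

Definition add_pendants_adj : rel (G + 'I_k)%type := fun x y =>
  match x, y with
  | inl u, inl w => adj u w
  | inl u, inr _ | inr _, inl u => u == v
  | inr _, inr _ => false
  end.

Lemma add_pendants_sym : symmetric add_pendants_adj.
Proof. by move=> [u|i] [w|j] //=; rewrite adj_sym. Qed.

Lemma add_pendants_irr : irreflexive add_pendants_adj.
Proof. by move=> [u|i] //=; rewrite adj_irr. Qed.

Definition add_pendants := SGraph add_pendants_sym add_pendants_irr.
End AddPendants.

Section Complete.
Variable r : nat.

Lemma complete_sym : symmetric (fun x y : 'I_r => x != y).
Proof. by move=> x y; rewrite eq_sym. Qed.

Lemma complete_irr : irreflexive (fun x y : 'I_r => x != y).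
Proof. by move=> x; rewrite eqxx. Qed.

Definition complete := SGraph complete_sym complete_irr.
End Complete.

(* K_r^t for t <= r: the new vertex is joined to the first t vertices of K_r. *)
Definition Krt (r t : nat) : sgraph :=
  add_vertex [set i : complete r | (val i < t)%N].

(* Main.v *)
Require Import Defs.
From mathcomp Require Import all_boot all_order all_algebra all_field zify ring.

Set Implicit Arguments.
Unset Strict Implicit.
Unset Printing Implicit Defensive.

Import GRing.Theory Num.Theory.

(** The j-th spectral moment is the trace of A^j, so the S-order compares first
    the triangles and then the closed 4-walks.  Moving the private neighbours of
    u to v (a Kelmans move, with u and v adjacent or with a common neighbour)
    keeps the graph connected and creates a triangle for each edge between the
    private neighbourhoods of u and v; if there is no such edge and both private
    neighbourhoods are nonempty, the number of closed 4-walks increases.  So the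
    last graph has nested neighbourhoods, that is, it is a threshold graph.  In
    a threshold graph some vertex v is adjacent to every non-isolated vertex;
    the triangles are those of the neighbourhood R of v plus one for each edge
    in R.
    Among threshold graphs with a given number of edges the number of triangles
    is thus largest when R is as small as possible, recursively, which forces a
    clique plus one partially joined vertex. *)

(** * Spectral moments as counts of closed walks *)

(** A real symmetric matrix is unitarily diagonalizable, and the trace of a power is read off the
    diagonal. That diagonal lists the [eigenvalues] up to order because both split the same
    characteristic polynomial. *)
Lemma moment_trace (j : nat) (G : sgraph) :
  spectral_moment j G = (\tr (adjmx G ^+ j))%R.
Proof.
set A := adjmx G.
have AT : (A^T = A)%R by apply/matrixP => x y; rewrite !mxE adj_sym.
have nA : A \is normalmx.
  apply: symmetric_normalmx.
    by apply/is_hermitianmxP; rewrite expr0 scale1r map_mx_id.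
  by apply/mxOverP => x y; rewrite !mxE realn.
have Pu := spectral_unit A; set P := spectralmx A in Pu.
pose D := spectral_diag A.
have DA : (A = invmx P *m diag_mx D *m P)%R by apply/orthomx_spectralP.
have DAj : (A ^+ j = invmx P *m diag_mx (map_mx (fun x => x ^+ j) D) *m P)%R.
  elim: j => [|j IH].
    rewrite expr0; have -> : (diag_mx (map_mx (fun x => x ^+ 0) D) = 1%:M)%R.
      by apply/matrixP => x y; rewrite !mxE expr0.
    by rewrite mulmx1 mulVmx.
  rewrite exprS {}IH {1}DA -[LHS]/(_ *m _)%R !mulmxA mulmxK //.
  rewrite -[X in (X *m P)%R]mulmxA mulmx_diag.
  congr (_ *m diag_mx _ *m _)%R.
  by apply/rowP => x; rewrite !mxE exprS.
rewrite DAj mxtrace_mulC mulmxA mulmxV // mul1mx mxtrace_diag.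
have eqD : perm_eq (eigenvalues A) [seq D ord0 i | i <- enum 'I_#|G|].
  apply: prod_XsubC_eq; rewrite -char_poly_eigenvalues big_map big_enum /=.
  have <- : char_poly (diag_mx D) = (\prod_i ('X - (D ord0 i)%:P))%R.
    rewrite char_poly_trig ?diag_mx_is_trig //.
    by apply: eq_bigr => x _; rewrite !mxE eqxx.
  pose PX := map_mx polyC P; pose QX := map_mx polyC (invmx P).
  have QP : (QX *m PX = 1%:M)%R by rewrite -map_mxM mulVmx // map_mx1.
  rewrite /char_poly.
  (* The similarity lifts to polynomial matrices, since the scalar matrix of ['X] commutes with
     [PX]. *)
  have -> : (char_poly_mx A = QX *m char_poly_mx (diag_mx D) *m PX)%R.
    rewrite /char_poly_mx mulmxBr mulmxBl -!map_mxM -DA.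
    by rewrite -mulmxA mul_scalar_mx -scalemxAr QP scalemx1.
  by rewrite !det_mulmx mulrAC -det_mulmx QP det1 mul1r.
transitivity (\sum_(x <- eigenvalues A) x ^+ j)%R.
  rewrite (big_nth 0%R) size_eigenvalues big_mkord; by [].
rewrite (perm_big _ eqD) big_map big_enum /=.
by apply: eq_bigr => x _; rewrite !mxE.
Qed.

(* Ordered counts: twice the edges within [W], six times its triangles. *)
Definition arcs (G : sgraph) (W : {set G}) : nat :=
  \sum_(x in W) \sum_(y in W) adj x y.
Definition tri (G : sgraph) (W : {set G}) : nat :=
  \sum_(x in W) \sum_(y in W) \sum_(z in W) adj x y * (adj x z * adj z y).
Definition codeg (G : sgraph) (x y : G) : nat := \sum_w adj x w * adj w y.
(** Closed walks of length 4, grouped by their first and third vertices. *)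
Definition walk4 (G : sgraph) : nat := \sum_(x : G) \sum_(y : G) codeg x y ^ 2.

Lemma codegC (G : sgraph) (x y : G) : codeg x y = codeg y x.
Proof. by apply: eq_bigr => w _; rewrite mulnC (adj_sym x) (adj_sym w). Qed.

(** The fibre of arcs over an edge is [(x, y)] and [(y, x)], distinct because there are no loops. *)
Lemma arcs_edges (G : sgraph) : arcs [set: G] = #|edges G|.*2.
Proof.
pose f (u : G * G) := [set u.1; u.2].
have -> : arcs [set: G] = \sum_(u in [set u : G * G | adj u.1 u.2]) 1.
  rewrite /arcs pair_big_dep [RHS]big_mkcond /= big_mkcond.
  by apply: eq_bigr => u _; rewrite !inE /=; case: adj.
rewrite (partition_big_imset f) /= -mul2n mulnC -sum_nat_const.
apply: eq_bigr => _ /imsetP[[x y] /= xy ->]; rewrite !inE /= in xy.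
have nxy : x != y by apply: contraTneq xy => ->; rewrite adj_irr.
rewrite sum1_card -[RHS]/(true.+1) -[in RHS](_ : (x, y) != (y, x)) => [|];
  last first.
  by apply: contra nxy => /eqP[->].
rewrite -cards2; apply: eq_card => -[a b]; rewrite !inE /=.
apply/andP/orP => [[ab /eqP /= fab]|]; last first.
  by case=> /eqP[-> ->]; rewrite inE /= ?xy ?(adj_sym y) ?xy /f /=
    ?(setUC [set y]) eqxx.
rewrite inE /= in ab.
have nab : a != b by apply: contraTneq ab => ->; rewrite adj_irr.
have: a \in f (x, y) by rewrite -fab !inE eqxx.
have: b \in f (x, y) by rewrite -fab !inE eqxx orbT.
move: nab; rewrite !inE => /negbTE nab /orP[]/eqP eb /orP[]/eqP ea.
all: by move: nab; rewrite ea eb ?eqxx; auto.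
Qed.

Lemma adjmx_sqr (G : sgraph) (i j : 'I_#|G|) :
  (adjmx G ^+ 2)%R i j = ((codeg (enum_val i) (enum_val j))%:R)%R.
Proof.
rewrite expr2 -[LHS]/((_ *m _)%R i j) mxE natr_sum.
rewrite (big_enum_val
  (fun w : G => ((adj (enum_val i) w * adj w (enum_val j))%:R)%R)).
by apply: eq_bigr => k _; rewrite !mxE natrM.
Qed.

Lemma spectral_moment1 (G : sgraph) : spectral_moment 1 G = 0%R.
Proof.
rewrite moment_trace expr1 /mxtrace big1 // => i _.
by rewrite !mxE adj_irr.
Qed.

Lemma spectral_moment2 (G : sgraph) :
  spectral_moment 2 G = ((arcs [set: G])%:R)%R.
Proof.
rewrite moment_trace /mxtrace /arcs.
rewrite natr_sum [RHS]big_mkcond /=.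
under [RHS]eq_bigr do rewrite in_setT.
rewrite [RHS](big_enum_val (fun x : G => _)).
apply: eq_bigr => i _; rewrite adjmx_sqr; congr (_%:R)%R.
rewrite /codeg [RHS]big_mkcond; apply: eq_bigr => w _.
by rewrite in_setT (adj_sym w); case: adj.
Qed.

Lemma spectral_moment3 (G : sgraph) :
  spectral_moment 3 G = ((tri [set: G])%:R)%R.
Proof.
rewrite moment_trace /mxtrace /tri natr_sum [RHS]big_mkcond /=.
under [RHS]eq_bigr do rewrite in_setT.
rewrite [RHS](big_enum_val (fun x : G => _)).
apply: eq_bigr => i _; rewrite exprS -[LHS]/((_ *m _)%R i i) mxE.
rewrite natr_sum [RHS]big_mkcond /=.
under [RHS]eq_bigr do rewrite in_setT.
rewrite [RHS](big_enum_val (fun x : G => _)).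
apply: eq_bigr => j _; rewrite adjmx_sqr !mxE -natrM; congr (_%:R)%R.
rewrite codegC /codeg big_distrr /= [RHS]big_mkcond; apply: eq_bigr => w _.
by rewrite in_setT.
Qed.

Lemma spectral_moment4 (G : sgraph) :
  spectral_moment 4 G = ((walk4 G)%:R)%R.
Proof.
rewrite moment_trace /mxtrace /walk4 natr_sum.
rewrite [RHS](big_enum_val (fun x : G => _)).
apply: eq_bigr => i _; rewrite (exprD _ 2 2) -[LHS]/((_ *m _)%R i i) mxE.
rewrite natr_sum [RHS](big_enum_val (fun x : G => _)).
apply: eq_bigr => j _; rewrite !adjmx_sqr -natrM; congr (_%:R)%R.
by rewrite codegC mulnn.
Qed.

Lemma triT (G : sgraph) : tri [set: G] =
  \sum_(x : G) \sum_(y : G) \sum_(z : G) adj x y * (adj x z * adj z y).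
Proof.
rewrite /tri big_mkcond; apply: eq_bigr => x _; rewrite in_setT.
rewrite big_mkcond; apply: eq_bigr => y _; rewrite in_setT.
by rewrite big_mkcond; apply: eq_bigr => z _; rewrite in_setT.
Qed.

Lemma arcsT (G : sgraph) : arcs [set: G] = \sum_(x : G) \sum_(y : G) adj x y.
Proof.
rewrite /arcs big_mkcond; apply: eq_bigr => x _; rewrite in_setT.
by rewrite big_mkcond; apply: eq_bigr => y _; rewrite in_setT.
Qed.

Lemma triT_codeg (G : sgraph) : tri [set: G] =
  \sum_(x : G) \sum_(y : G) adj x y * codeg x y.
Proof.
rewrite triT; apply: eq_bigr => x _; apply: eq_bigr => y _.
by rewrite /codeg big_distrr.
Qed.

Lemma tri_iso (G H : sgraph) :
  isomorphic G H -> tri [set: G] = tri [set: H].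
Proof.
case=> f /(onW_bij xpredT) fB fA; rewrite !triT [RHS](reindex f) //.
apply: eq_bigr => x _; rewrite [RHS](reindex f) //.
apply: eq_bigr => y _; rewrite [RHS](reindex f) //.
by apply: eq_bigr => z _; rewrite !fA.
Qed.

Lemma walk4_iso (G H : sgraph) : isomorphic G H -> walk4 G = walk4 H.
Proof.
case=> f /(onW_bij xpredT) fB fA; rewrite /walk4 [RHS](reindex f) //.
apply: eq_bigr => x _; rewrite [RHS](reindex f) //.
apply: eq_bigr => y _; rewrite /codeg [in RHS](reindex f) //; congr (_ ^ 2).
by apply: eq_bigr => z _; rewrite !fA.
Qed.

(** Moments 1 and 2 are 0 and 2m, so the first difference occurs at index 3 (triangles), 4 (closed
    4-walks) or later (both agree). *)
Lemma last_lexi (m n : nat) (Gs G : sgraph) :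
  last_in_S_order m n Gs -> conn_graph m n G ->
  tri [set: G] <= tri [set: Gs] /\
  (tri [set: G] = tri [set: Gs] -> walk4 G <= walk4 Gs).
Proof.
move=> [[_ mGs nGs] lastGs] cG; have [_ mG nG] := cG.
have prec : ~ isomorphic G Gs -> tri [set: G] <= tri [set: Gs] /\
    (tri [set: G] = tri [set: Gs] -> walk4 G <= walk4 Gs).
  case/(lastGs _ cG) => j [/andP[j0 _]]; case: j j0 => // -[|[|[|[|j]]]] _ eqS.
  - by rewrite !spectral_moment1 Order.POrderTheory.ltxx.
  - by rewrite !spectral_moment2 !arcs_edges mG mGs Order.POrderTheory.ltxx.
  - by rewrite !spectral_moment3 ltr_nat; lia.
  - have /eqP := eqS 3%N isT; rewrite !spectral_moment3 eqr_nat.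
    by rewrite !spectral_moment4 ltr_nat; lia.
  - have /eqP := eqS 3%N isT; rewrite !spectral_moment3 eqr_nat => /eqP.
    have /eqP := eqS 4%N isT; rewrite !spectral_moment4 eqr_nat => /eqP.
    by lia.
(* The conclusion is a boolean, so it may be refuted first; that refutes isomorphism, and [prec]
   applies. *)
have [|/negP lt] := boolP ((tri [set: G] <= tri [set: Gs]) &&
    ((tri [set: G] == tri [set: Gs]) ==> (walk4 G <= walk4 Gs))).
  by case/andP=> -> /implyP h; split=> // /eqP/h.
apply: prec => iso; apply: lt.
by rewrite (tri_iso iso) (walk4_iso iso) !leqnn implybT.
Qed.

(** * Kelmans moves *)

(* The Kelmans move from [u] to [v]: common neighbours stay common, and [v]
   takes over the other neighbours of [u]. *)
Definition kelmans_adj (G : sgraph) (u v : G) : rel G := fun x y =>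
  if x == u then
    if (y == u) || (y == v) then adj x y else adj u y && adj v y
  else if x == v then
    if (y == u) || (y == v) then adj x y else adj u y || adj v y
  else if y == u then adj u x && adj v x
  else if y == v then adj u x || adj v x
  else adj x y.

Lemma kelmans_sym (G : sgraph) (u v : G) : symmetric (kelmans_adj u v).
Proof.
move=> x y; rewrite /kelmans_adj (adj_sym x y).
by case: (x == u); case: (x == v); case: (y == u); case: (y == v).
Qed.

Lemma kelmans_irr (G : sgraph) (u v : G) : irreflexive (kelmans_adj u v).
Proof.
move=> x; rewrite /kelmans_adj !adj_irr.
by case: (x == u); case: (x == v).
Qed.

Definition kelmans (G : sgraph) (u v : G) : sgraph :=
  SGraph (kelmans_sym u v) (kelmans_irr u v).

Lemma kelmans_off (G : sgraph) (u v x y : G) :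
  (x != u) && (x != v) -> (y != u) && (y != v) ->
  @adj (kelmans u v) x y = adj x y.
Proof.
by case/andP=> /negbTE xu /negbTE xv /andP[/negbTE yu /negbTE yv];
  rewrite /= /kelmans_adj xu xv yu yv.
Qed.

Lemma kelmans_pair (G : sgraph) (u v : G) :
  @adj (kelmans u v) u v = adj u v.
Proof. by rewrite /= /kelmans_adj !eqxx orbT. Qed.

Lemma kelmans_l (G : sgraph) (u v x : G) : (x != u) && (x != v) ->
  @adj (kelmans u v) u x = adj u x && adj v x.
Proof.
by case/andP=> /negbTE xu /negbTE xv; rewrite /= /kelmans_adj eqxx xu xv.
Qed.

Lemma kelmans_r (G : sgraph) (u v x : G) :
  u != v -> (x != u) && (x != v) ->
  @adj (kelmans u v) v x = adj u x || adj v x.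
Proof.
move=> /negbTE uv /andP[/negbTE xu /negbTE xv].
by rewrite /= /kelmans_adj eqxx eq_sym uv xu xv.
Qed.

(** Each old edge remains a connection: an edge at [u] is rerouted through [v], and [u] stays
    connected to [v] by their edge or by a common neighbour, which the move keeps. *)
Lemma kelmans_connected (G : sgraph) (u v : G) : u != v ->
  adj u v || [exists w, adj u w && adj v w] ->
  connected G -> connected (kelmans u v).
Proof.
move=> uv near cG; pose e := @adj (kelmans u v).
have eC : connect_sym e by apply: sym_connect_sym; apply: adj_sym.
have cuv : connect e u v.
  case/orP: near => [auv|/existsP[w /andP[uw vw]]].
    by apply: connect1; rewrite /e kelmans_pair.
  have Dw : (w != u) && (w != v).
    by apply/andP; split; [apply: contraTneq uw | apply: contraTneq vw] => ->;
      rewrite adj_irr.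
  apply: (@connect_trans _ _ w); first by rewrite connect1 // /e kelmans_l ?uw.
  by rewrite eC connect1 // /e kelmans_r // uw.
have main (x y : G) : adj x y -> connect e x y.
  have [|Dx] := boolP ((x != u) && (x != v));
  have [|Dy] := boolP ((y != u) && (y != v)).
  - by move=> Dy Dx a; rewrite connect1 // /e kelmans_off.
  - move=> Dx; move: Dy; rewrite negb_and !negbK => /orP[]/eqP-> a.
      rewrite eC; apply: (connect_trans cuv).
      by rewrite connect1 // /e kelmans_r // adj_sym a.
    by rewrite eC connect1 // /e kelmans_r // (adj_sym v) a orbT.
  - move=> Dy; move: Dx; rewrite negb_and !negbK => /orP[]/eqP-> a.
      apply: (connect_trans cuv).
      by rewrite connect1 // /e kelmans_r // a.
    by rewrite connect1 // /e kelmans_r // a orbT.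
  move: Dx Dy; rewrite !negb_and !negbK => /orP[]/eqP-> /orP[]/eqP-> _ //.
  by rewrite eC.
move=> x y; apply: (connect_sub _ (cG x y)) => a b; exact: main.
Qed.

Lemma sum_split2 (T : finType) (u v : T) (F : T -> nat) : u != v ->
  \sum_x F x = F u + F v + \sum_(x | (x != u) && (x != v)) F x.
Proof.
by move=> uv; rewrite (bigD1 u) //= (bigD1 v) 1?eq_sym //= addnA.
Qed.

Lemma sum_sym_split2 (T : finType) (u v : T) (F : T -> T -> nat) :
  u != v -> (forall x y, F x y = F y x) ->
  \sum_x \sum_y F x y = F u u + F v v + 2 * F u v +
    2 * (\sum_(x | (x != u) && (x != v)) (F u x + F v x)) +
    \sum_(x | (x != u) && (x != v)) \sum_(y | (y != u) && (y != v)) F x y.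
Proof.
move=> uv FC; rewrite (sum_split2 _ uv) !(sum_split2 _ uv).
under [X in _ + X]eq_bigr do rewrite (sum_split2 _ uv).
rewrite !big_split /= (FC v u).
under [X in _ + (X + _ + _)]eq_bigr do rewrite FC.
under [X in _ + (_ + X + _)]eq_bigr do rewrite FC.
lia.
Qed.

(** Every other vertex keeps its number of edges to the pair, since and plus or of two bits is their
    sum. *)
Lemma kelmans_arcs (G : sgraph) (u v : G) : u != v ->
  arcs [set: kelmans u v] = arcs [set: G].
Proof.
move=> uv; set K := kelmans u v.
rewrite !arcsT (@sum_sym_split2 G u v (@adj K)) //; last first.
  by move=> x y; rewrite adj_sym.
rewrite (@sum_sym_split2 G u v (@adj G)) //; last first.
  by move=> x y; rewrite adj_sym.
rewrite !adj_irr kelmans_pair; congr (_ + 2 * _ + _).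
  apply: eq_bigr => x Dx; rewrite kelmans_l // kelmans_r //.
  by case: adj; case: adj.
by apply: eq_bigr => x Dx; apply: eq_bigr => y Dy; rewrite kelmans_off.
Qed.

Section Split.
Variables (G : sgraph) (u v : G).
Hypothesis uv : u != v.

Lemma codeg_uu : codeg u u =
  adj u v + \sum_(w | (w != u) && (w != v)) adj u w.
Proof.
rewrite /codeg (sum_split2 _ uv) adj_irr (adj_sym v u) add0n; congr (_ + _).
  by case: adj.
by apply: eq_bigr => w _; rewrite (adj_sym w); case: adj.
Qed.

Lemma codeg_uv : codeg u v =
  \sum_(w | (w != u) && (w != v)) adj u w * adj v w.
Proof.
rewrite /codeg (sum_split2 _ uv) !adj_irr muln0 add0n.
by apply: eq_bigr => w _; rewrite (adj_sym w).
Qed.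

Lemma codeg_ux (x : G) : codeg u x =
  adj u v * adj v x + \sum_(w | (w != u) && (w != v)) adj u w * adj w x.
Proof. by rewrite /codeg (sum_split2 _ uv) !adj_irr add0n. Qed.

Lemma codeg_xy (x y : G) : codeg x y =
  adj u x * adj u y + adj v x * adj v y +
  \sum_(w | (w != u) && (w != v)) adj x w * adj w y.
Proof. by rewrite /codeg (sum_split2 _ uv) !(adj_sym x). Qed.
End Split.

Lemma sum_off_pairC (T : finType) (u v : T) (F : T -> nat) :
  \sum_(w | (w != u) && (w != v)) F w = \sum_(w | (w != v) && (w != u)) F w.
Proof. by apply: eq_bigl => w; rewrite andbC. Qed.

Lemma codeg_vx (G : sgraph) (u v x : G) : u != v -> codeg v x =
  adj u v * adj u x + \sum_(w | (w != u) && (w != v)) adj v w * adj w x.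
Proof.
by move=> uv; rewrite (@codeg_ux G v u) 1?eq_sym // sum_off_pairC adj_sym.
Qed.

Lemma codeg_vv (G : sgraph) (u v : G) : u != v -> codeg v v =
  adj u v + \sum_(w | (w != u) && (w != v)) adj v w.
Proof.
by move=> uv; rewrite (@codeg_uu G v u) 1?eq_sym // sum_off_pairC adj_sym.
Qed.

(** Ordered triangles containing both [u] and [v] (6 orders of the triple), exactly one of them (3
    positions for it), or neither. *)
Lemma tri_split (G : sgraph) (u v : G) : u != v -> tri [set: G] =
  6 * (adj u v * \sum_(x | (x != u) && (x != v)) adj u x * adj v x) +
  3 * (\sum_(x | (x != u) && (x != v)) \sum_(y | (y != u) && (y != v))
    adj x y * (adj u x * adj u y + adj v x * adj v y)) +
  \sum_(x | (x != u) && (x != v)) \sum_(y | (y != u) && (y != v))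
    adj x y * \sum_(w | (w != u) && (w != v)) adj x w * adj w y.
Proof.
move=> uv; rewrite triT_codeg (sum_sym_split2 uv); last first.
  by move=> x y; rewrite codegC adj_sym.
rewrite !adj_irr (codeg_uv uv).
set Q := (X in 3 * X); set M := (X in _ = _ + _ + X).
set P := \sum_(w | _) adj u w * adj v w.
have -> : \sum_(x | (x != u) && (x != v))
    (adj u x * codeg u x + adj v x * codeg v x) = 2 * (adj u v * P) + Q.
  rewrite /P /Q mulnA !big_distrr /= -big_split; apply: eq_bigr => x Dx.
  rewrite (codeg_ux uv) (codeg_vx _ uv) !mulnDr addnACA; congr (_ + _).
    by rewrite /=; lia.
  rewrite !big_distrr -big_split /=; apply: eq_bigr => y _.
  by rewrite (adj_sym y); lia.
have -> : \sum_(x | (x != u) && (x != v)) \sum_(y | (y != u) && (y != v))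
    adj x y * codeg x y = Q + M.
  rewrite /Q /M -big_split; apply: eq_bigr => x Dx.
  rewrite -big_split; apply: eq_bigr => y Dy.
  by rewrite (codeg_xy uv) mulnDr.
lia.
Qed.

Lemma leq_sum2 (T : finType) (P : pred T) (E F : T -> T -> nat) :
  (forall x y, P x -> P y -> E x y <= F x y) ->
  \sum_(x | P x) \sum_(y | P y) E x y <= \sum_(x | P x) \sum_(y | P y) F x y.
Proof. by move=> EF; apply: leq_sum => x Px; apply: leq_sum => y; apply: EF. Qed.

Lemma ltn_sum (T : finType) (P : pred T) (E F : T -> nat) (a : T) :
  (forall x, P x -> E x <= F x) -> P a -> E a < F a ->
  \sum_(x | P x) E x < \sum_(x | P x) F x.
Proof.
move=> EF Pa lt; rewrite (bigD1 a) // [X in _ < X](bigD1 a) //=.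
by rewrite -addSn leq_add // leq_sum // => x /andP[/EF].
Qed.

(** Convexity of the square, for two codegrees whose sum the move preserves while it pushes them
    apart. *)
Lemma sqr_spread (a b c d : nat) : a + b = c + d -> c <= a -> c <= b ->
  a ^ 2 + b ^ 2 + 2 * ((a - c) * (b - c)) = c ^ 2 + d ^ 2.
Proof.
move=> abcd /subnKC ca /subnKC cb.
have -> : d = c + (a - c) + (b - c) by lia.
rewrite -{1}ca -{1}cb; ring.
Qed.

Lemma sqr_spread_le (a b c d : nat) : a + b = c + d -> c <= a -> c <= b ->
  a ^ 2 + b ^ 2 <= c ^ 2 + d ^ 2.
Proof. by move=> abcd ca cb; rewrite -(sqr_spread abcd ca cb) leq_addr. Qed.

Lemma sqr_spread_lt (a b c d : nat) : a + b = c + d -> c < a -> c < b ->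
  a ^ 2 + b ^ 2 < c ^ 2 + d ^ 2.
Proof.
move=> abcd ca cb; rewrite -(sqr_spread abcd (ltnW ca) (ltnW cb)).
by rewrite -addn1 leq_add2l !muln_gt0 !subn_gt0 ca.
Qed.

Section Kelmans.
Variables (G : sgraph) (u v : G).
Hypothesis uv : u != v.
Let K := kelmans u v.

Lemma kelmans_rest (x y : G) : (x != u) && (x != v) -> (y != u) && (y != v) ->
  \sum_(w | (w != u) && (w != v)) @adj K x w * @adj K w y =
  \sum_(w | (w != u) && (w != v)) adj x w * adj w y.
Proof. by move=> Dx Dy; apply: eq_bigr => w Dw; rewrite !kelmans_off. Qed.

(** Rearrangement inequality: the left side is an inner product of two 0-1 pairs, and the move sorts
    both pairs in the same direction. *)
Lemma kelmans_pq (x y : G) : (x != u) && (x != v) -> (y != u) && (y != v) ->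
  adj u x * adj u y + adj v x * adj v y <=
  @adj K u x * @adj K u y + @adj K v x * @adj K v y.
Proof.
move=> Dx Dy; rewrite !kelmans_l ?kelmans_r //.
by do 4 case: adj.
Qed.

Lemma kelmans_common :
  \sum_(x | (x != u) && (x != v)) @adj K u x * @adj K v x =
  \sum_(x | (x != u) && (x != v)) adj u x * adj v x.
Proof.
apply: eq_bigr => x Dx; rewrite kelmans_l ?kelmans_r //.
by do 2 case: adj.
Qed.

Lemma kelmans_tri_le : tri [set: G] <= tri [set: K].
Proof.
rewrite (tri_split uv) (@tri_split K u v uv) kelmans_pair kelmans_common.
rewrite leq_add //; last first.
  by apply: leq_sum2 => x y Dx Dy; rewrite kelmans_off // kelmans_rest.
rewrite leq_add2l leq_pmul2l //; apply: leq_sum2 => x y Dx Dy.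
by rewrite kelmans_off // leq_mul2l kelmans_pq // orbT.
Qed.

(** The edge [a b] lies over neither [u] nor [v] before the move, and forms a triangle with [v]
    after it. *)
Lemma kelmans_tri_lt (a b : G) : a != v -> b != u ->
  adj u a -> ~~ adj v a -> adj v b -> ~~ adj u b -> adj a b ->
  tri [set: G] < tri [set: K].
Proof.
move=> av bu ua nva vb nub ab.
have Da : (a != u) && (a != v).
  by rewrite av andbT; apply: contraTneq ua => ->; rewrite adj_irr.
have Db : (b != u) && (b != v).
  by rewrite bu; apply: contraTneq vb => ->; rewrite adj_irr.
rewrite (tri_split uv) (@tri_split K u v uv) kelmans_pair kelmans_common.
rewrite -addSn leq_add //; last first.
  by apply: leq_sum2 => x y Dx Dy; rewrite kelmans_off // kelmans_rest.
rewrite ltn_add2l ltn_pmul2l //.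
have le x y : (x != u) && (x != v) -> (y != u) && (y != v) ->
    adj x y * (adj u x * adj u y + adj v x * adj v y) <=
    @adj K x y * (@adj K u x * @adj K u y + @adj K v x * @adj K v y).
  by move=> Dx Dy; rewrite kelmans_off // leq_mul2l kelmans_pq // orbT.
apply: (@ltn_sum _ _ _ _ a) => // [x Dx|].
  by apply: leq_sum => y; apply: le.
apply: (@ltn_sum _ _ _ _ b) => // [y Dy|]; first exact: le.
rewrite kelmans_off // ab !kelmans_l // !kelmans_r // ua vb.
by rewrite (negbTE nva) (negbTE nub).
Qed.

Lemma kelmans_walk4_lt (a0 b0 : G) : a0 != v -> b0 != u ->
  adj u a0 -> ~~ adj v a0 -> adj v b0 -> ~~ adj u b0 ->
  (forall a b, a != v -> b != u ->
   adj u a -> ~~ adj v a -> adj v b -> ~~ adj u b -> ~~ adj a b) ->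
  walk4 G < walk4 K.
Proof.
move=> av bu ua nva vb nub AB.
have Da : (a0 != u) && (a0 != v).
  by rewrite av andbT; apply: contraTneq ua => ->; rewrite adj_irr.
have Db : (b0 != u) && (b0 != v).
  by rewrite bu; apply: contraTneq vb => ->; rewrite adj_irr.
rewrite /walk4 (sum_sym_split2 uv); last by move=> x y; rewrite codegC.
rewrite (@sum_sym_split2 K u v _ uv); last by move=> x y; rewrite codegC.
(* The strict gain is charged to the entries indexed by [u] and [v] alone; the other blocks only
   need to be non-decreasing. *)
rewrite -!addSn leq_add //; last first.
  apply: leq_sum2 => x y Dx Dy; rewrite leq_sqr.
  rewrite (codeg_xy uv) (@codeg_xy K u v uv) kelmans_rest //.
  by rewrite leq_add2r kelmans_pq.
rewrite leq_add //; last first.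
  rewrite leq_pmul2l //; apply: leq_sum => x Dx.
  rewrite (codeg_ux uv) (codeg_vx _ uv) (@codeg_ux K u v uv).
  rewrite (@codeg_vx K u v x uv).
  rewrite kelmans_pair kelmans_l // kelmans_r //.
  under [X in _ <= (_ + X) ^ 2 + _]eq_bigr => w Dw do
    rewrite kelmans_l // kelmans_off //.
  under [X in _ <= _ + (_ + X) ^ 2]eq_bigr => w Dw do
    rewrite kelmans_r // kelmans_off //.
  set P := \sum_(w | _) adj u w * adj w x.
  set Q := \sum_(w | _) adj v w * adj w x.
  set P' := \sum_(w | _) (adj u w && adj v w) * adj w x.
  set Q' := \sum_(w | _) (adj u w || adj v w) * adj w x.
  have PQ : P' + Q' = P + Q.
    rewrite /P /Q /P' /Q' -!big_split; apply: eq_bigr => w _ /=.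
    by case: adj; case: adj; case: adj.
  have PP : P' <= P.
    by apply: leq_sum => w _; rewrite leq_mul2r; do 3 case: adj.
  have PQ' : P' <= Q.
    by apply: leq_sum => w _; rewrite leq_mul2r; do 3 case: adj.
  (* If [x] sees both or neither of [u], [v], the two codegrees spread. If [x] is private to one, a
     possible edge [u v] contributes to only one of them; [AB] then forces the two new codegrees to
     be the old ones, swapped when [x] is private to [u] and unchanged when private to [v]. *)
  case ux: (adj u x); case vx: (adj v x); rewrite /= ?muln1 ?muln0 ?add0n.
  - by apply: sqr_spread_le; rewrite ?leq_add2l // addnACA -PQ addnACA.
  - have : Q <= P'.
      apply: leq_sum => w /andP[wu wv].
      have [vw|] := boolP (adj v w); rewrite ?andbF // andbT.
      have [|uw] := boolP (adj u w) => //=.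
      rewrite (negbTE (_ : ~~ adj w x)) // adj_sym.
      by apply: AB => //; rewrite ?vx //; case/andP: Dx.
    move=> le; have eP : P' = Q by apply/eqP; rewrite eqn_leq PQ'.
    by move: PQ; rewrite eP [RHS]addnC => /addnI ->; rewrite addnC.
  - have : P <= P'.
      apply: leq_sum => w /andP[wu wv].
      have [uw|] := boolP (adj u w); rewrite ?andbF //=.
      have [|vw] := boolP (adj v w) => //=.
      rewrite (negbTE (_ : ~~ adj w x)) //.
      by apply: AB => //; rewrite ?ux //; case/andP: Dx.
    move=> le; have eP : P' = P by apply/eqP; rewrite eqn_leq PP.
    by move: PQ; rewrite eP => /addnI ->.
  - exact: sqr_spread_le.
(* The diagonal codegrees are degrees. Losing [a0] puts the new degree of [u] below its old one, and
   lacking [b0] puts it below the old degree of [v], so the spread is strict. *)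
rewrite (codeg_uu uv) (codeg_vv uv) (codeg_uv uv).
rewrite (@codeg_uu K u v uv) (@codeg_vv K u v uv) (@codeg_uv K u v uv).
rewrite kelmans_pair kelmans_common leq_add //.
set P := \sum_(w | _) adj u w; set Q := \sum_(w | _) adj v w.
set P' := \sum_(w | _) @adj K u w; set Q' := \sum_(w | _) @adj K v w.
have PQ : P' + Q' = P + Q.
  rewrite /P /Q /P' /Q' -!big_split; apply: eq_bigr => w Dw.
  by rewrite kelmans_l // kelmans_r //; case: adj; case: adj.
have PP : P' < P.
  apply: (@ltn_sum _ _ _ _ a0) => // [w Dw|]; rewrite kelmans_l //;
    last by rewrite ua (negbTE nva).
  by case: adj; case: adj.
have PQ' : P' < Q.
  apply: (@ltn_sum _ _ _ _ b0) => // [w Dw|]; rewrite kelmans_l //;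
    last by rewrite vb (negbTE nub).
  by case: adj; case: adj.
rewrite addSn; apply: sqr_spread_lt; rewrite ?ltn_add2l //.
by rewrite addnACA -PQ addnACA.
Qed.
End Kelmans.

(** * Triangles in threshold graphs *)

(** For any two vertices, the neighbourhoods, each taken without the other vertex, are nested: the
    total vicinal preorder of threshold graphs. *)
Definition threshold (G : sgraph) : Prop := forall u v a b : G,
  a != v -> b != u -> adj u a -> ~~ adj v a -> adj v b -> adj u b.

(** Otherwise the Kelmans graph is a competitor. Lastness forces equal triangle counts, hence no
    edge between private neighbourhoods, and then the closed 4-walks increase. *)
Lemma last_nested (m n : nat) (G : sgraph) (u v a b : G) :
  last_in_S_order m n G -> adj u v || [exists w, adj u w && adj v w] ->
  a != v -> b != u -> adj u a -> ~~ adj v a -> adj v b -> adj u b.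
Proof.
move=> lastG near av bu ua nva vb; apply/idPn => nub.
have uv : u != v by apply: contraTneq ua => ->.
have [[cG mG nG] _] := lastG.
have cK : conn_graph m n (kelmans u v).
  split=> //; first exact: kelmans_connected.
  by apply: double_inj; rewrite -arcs_edges kelmans_arcs // arcs_edges mG.
have [le_tri le_walk] := last_lexi lastG cK.
have eq_tri : tri [set: kelmans u v] = tri [set: G].
  by apply/eqP; rewrite eqn_leq le_tri kelmans_tri_le.
have := le_walk eq_tri; rewrite leqNgt; case/negP.
apply: (kelmans_walk4_lt uv av bu) => // c d cv du uc nvc vd nud.
apply/negP => cd; have := kelmans_tri_lt uv cv du uc nvc vd nud cd.
by rewrite eq_tri ltnn.
Qed.

(** This discharges the proximity condition of [last_nested]: the ball [N] of radius two about [u]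
    is closed under adjacency, so by connectedness it contains every vertex. *)
Lemma last_near (m n : nat) (G : sgraph) (u v : G) :
  last_in_S_order m n G -> u != v ->
  adj u v || [exists w, adj u w && adj v w].
Proof.
move=> lastG uv; have [[cG _ _] _] := lastG.
pose N := [pred x | (x == u) || adj u x || [exists w, adj u w && adj x w]].
have Ncl : closed (@adj G) N.
  apply: (intro_closed (sym_connect_sym (@adj_sym G))) => x y xy.
  rewrite !inE -orbA => /or3P[/eqP xu|ux|/existsP[a /andP[ua xa]]].
  - by rewrite -xu xy orbT.
  - by apply/orP; right; apply/existsP; exists x; rewrite ux adj_sym.
  have [-> //|yu] := eqVneq y u; have [uy //|nuy] := boolP (adj u y).
  rewrite /=; have [ux|nux] := boolP (adj u x).
    by apply/existsP; exists x; rewrite ux adj_sym.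
  have [ya|nya] := boolP (adj y a).
    by apply/existsP; exists a; rewrite ua ya.
  have ax : adj a x by rewrite adj_sym.
  have [xu|xu] := eqVneq x u; first by rewrite xu in xy; rewrite xy in nuy.
  suff xu' : adj x u by rewrite adj_sym xu' in nux.
  (* On a path [u], [a], [x], [y] leaving the ball, the adjacent vertices [x] and [a] have private
     neighbours [y] and [u], against nestedness. *)
  apply: (@last_nested _ _ _ x a y u lastG) => //.
  - by rewrite adj_sym ax.
  - by apply: contraTneq ua => <-.
  - by rewrite eq_sym.
  - by rewrite adj_sym.
  - by rewrite adj_sym.
have := closed_connect Ncl (cG u v); rewrite !inE eqxx /= => /esym.
by rewrite eq_sym (negbTE uv).
Qed.

Lemma last_is_threshold (m n : nat) (G : sgraph) :
  last_in_S_order m n G -> threshold G.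
Proof.
move=> lastG u v a b av bu ua nva vb.
apply: (last_nested lastG (last_near lastG _) av) => //.
by apply: contraTneq ua => ->.
Qed.

Definition nbr (G : sgraph) (v : G) (W : {set G}) := [set x in W | adj v x].

Lemma arcs_nbr (G : sgraph) (v : G) (W : {set G}) : arcs (nbr v W) =
  \sum_(x in W) \sum_(y in W) adj v x * (adj v y * adj x y).
Proof.
rewrite /arcs big_mkcond [RHS]big_mkcond; apply: eq_bigr => x _.
rewrite inE; case: (x \in W) => //=; case vx: (adj v x); last first.
  by rewrite big1 // => y _; rewrite mul0n.
rewrite big_mkcond [RHS]big_mkcond; apply: eq_bigr => y _; rewrite inE.
by case: (y \in W); case: (adj v y); rewrite /= ?mul1n.
Qed.

Lemma arcsU1 (G : sgraph) (v : G) (W : {set G}) : v \notin W ->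
  arcs (v |: W) = arcs W + 2 * #|nbr v W|.
Proof.
move=> vW; have deg : \sum_(x in W) (adj v x : nat) = #|nbr v W|.
  rewrite -sum1_card big_mkcond [RHS]big_mkcond; apply: eq_bigr => x _.
  by rewrite inE; case: (x \in W); case: adj.
rewrite /arcs !big_setU1 //= adj_irr add0n deg.
under eq_bigr => x xW do rewrite big_setU1 //= (adj_sym x v).
by rewrite big_split /= deg; lia.
Qed.

(** An ordered triangle through [v] is an arc between neighbours of [v] with one of three positions
    for [v]. *)
Lemma triU1 (G : sgraph) (v : G) (W : {set G}) : v \notin W ->
  tri (v |: W) = tri W + 3 * arcs (nbr v W).
Proof.
move=> vW; rewrite /tri !big_setU1 //= !adj_irr big1 => [|z _]; last first.
  by rewrite mul0n.
have E1 : \sum_(y in W) \sum_(z in v |: W)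
    adj v y * (adj v z * adj z y) = arcs (nbr v W).
  rewrite arcs_nbr; apply: eq_bigr => y _; rewrite big_setU1 //= adj_irr muln0.
  by apply: eq_bigr => z _; rewrite (adj_sym z).
rewrite E1.
under eq_bigr => x xW.
  rewrite !big_setU1 //= adj_irr !muln0 add0n.
  under [X in _ + X]eq_bigr => y yW do rewrite big_setU1 //=.
  rewrite big_split /=; over.
rewrite !big_split /= -/(tri W).
have -> : \sum_(x in W) \sum_(z in W) adj x v * (adj x z * adj z v) =
    arcs (nbr v W).
  rewrite arcs_nbr; apply: eq_bigr => x _; apply: eq_bigr => y _.
  by rewrite (adj_sym x v) (adj_sym y v) (mulnC (adj x y)).
have -> : \sum_(x in W) \sum_(y in W) adj x y * (adj x v * adj v y) =
    arcs (nbr v W).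
  rewrite arcs_nbr; apply: eq_bigr => x _; apply: eq_bigr => y _.
  by rewrite (adj_sym x v) mulnC mulnA.
by rewrite /tri; lia.
Qed.

(** By symmetry both ends of every edge in [W] lie in [R], so the vertices outside [R] are isolated
    in [W]. *)
Lemma arcs_core (G : sgraph) (R W : {set G}) : R \subset W ->
  {in W &, forall x y, adj x y -> x \in R} -> arcs W = arcs R.
Proof.
move=> /subsetP RW core; rewrite /arcs big_mkcond [RHS]big_mkcond.
apply: eq_bigr => x _.
case xR: (x \in R); last first.
  case: ifP => xW //; rewrite big1 // => y yW.
  by case xy: (adj x y) => //; rewrite (core x y) in xR.
rewrite RW // big_mkcond [RHS]big_mkcond; apply: eq_bigr => y _.
case yR: (y \in R); first by rewrite RW.
case: ifP => yW //; case xy: (adj x y) => //.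
by rewrite (core y x) // ?RW // adj_sym in yR.
Qed.

Lemma tri_core (G : sgraph) (R W : {set G}) : R \subset W ->
  {in W &, forall x y, adj x y -> x \in R} -> tri W = tri R.
Proof.
move=> /subsetP RW core; rewrite /tri big_mkcond [RHS]big_mkcond.
apply: eq_bigr => x _.
case xR: (x \in R); last first.
  case: ifP => xW //; rewrite big1 // => y yW; rewrite big1 // => z zW.
  by case xy: (adj x y) => //; rewrite (core x y) in xR.
rewrite RW // big_mkcond [RHS]big_mkcond; apply: eq_bigr => y _.
case yR: (y \in R); last first.
  case: ifP => yW //; rewrite big1 // => z zW.
  by case xy: (adj x y) => //; rewrite (core y x) // ?RW // adj_sym in yR.
rewrite RW // big_mkcond [RHS]big_mkcond; apply: eq_bigr => z _.
case zR: (z \in R); first by rewrite RW.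
case: ifP => zW //; case xz: (adj x z); rewrite ?muln0 //.
by rewrite (core z x) // ?RW // adj_sym in zR.
Qed.

Lemma arcs_le (G : sgraph) (W : {set G}) : arcs W <= 2 * 'C(#|W|, 2).
Proof.
rewrite -mul_bin_diag bin1 -sum_nat_const; apply: leq_sum => x xW.
rewrite (cardsD1 x W) xW /= -sum1_card big_mkcond [leqRHS]big_mkcond.
apply: leq_sum => y _; rewrite !inE.
by case: eqVneq => [->|_]; rewrite ?adj_irr; case: (_ \in W) => //=; case: adj.
Qed.

(* A vertex of maximal degree in [W] works: if it missed [x], with [x]
   adjacent to [y], then [y] would have larger degree. *)
Lemma threshold_dominating (G : sgraph) (W : {set G}) (v0 : G) :
  threshold G -> v0 \in W ->
  exists2 v, v \in W &
    {in W &, forall x y, adj x y -> x \in v |: nbr v W}.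
Proof.
move=> thr v0W; case: (arg_maxnP (fun v => #|nbr v W|) v0W) => v mem_v max.
have vW : v \in W by [].
exists v => // x y xW yW xy; rewrite !inE xW /=.
have [//|xv] := eqVneq x v; apply/idPn => /= nvx.
have yx : adj y x by rewrite adj_sym.
have step b : b != y -> adj v b -> adj y b by move=> yb vb; apply: (thr y v x).
have yv : y != v by apply: contraTneq yx => ->.
(* Compared with [v], the vertex [y] gains [x]; if [v] and [y] are adjacent, [v] replaces [y] in the
   set. Either way the set is larger than [nbr v W], against maximality. *)
have sub : (if adj v y then v |: (x |: nbr v W :\ y) else x |: nbr v W) \subset
    nbr y W.
  apply/subsetP => b; case: ifP => vy; rewrite !inE.
    case/or3P=> [/eqP->|/eqP->|/and3P[yb bW vb]].
    - by rewrite vW adj_sym.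
    - by rewrite xW yx.
    - by rewrite bW step.
  case/orP=> [/eqP->|/andP[bW vb]]; first by rewrite xW yx.
  by rewrite bW step //; apply: contraFneq vy => <-.
have := subset_leq_card sub; have := max y yW; rewrite /= => le1 le2.
have := leq_trans le2 le1; case: ifP => vy.
  rewrite !cardsU1 !inE adj_irr (negbTE nvx) !andbF (eq_sym v x) (negbTE xv) /=.
  by rewrite (cardsD1 y (nbr v W)) !inE yW vy; lia.
by rewrite cardsU1 !inE (negbTE nvx) andbF /=; lia.
Qed.

(** A clique on the first [a] positions, position [a] joined to the first [b], isolated vertices
    after. Giving it as a numbering lets isomorphisms be built by matching positions. *)
Definition quasi_clique (G : sgraph) (a b : nat) (s : seq G) : Prop :=
  forall x0 i j, i < j < size s ->
    adj (nth x0 s i) (nth x0 s j) = (j < a) || (j == a) && (i < b).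

(** A vertex dominating [s1] enters at position 0 and shifts both thresholds by one; [s2] supplies
    the isolated tail. *)
Lemma quasi_clique_cons (G : sgraph) (a b : nat) (v : G) (s1 s2 : seq G) :
  size s1 = a.+1 -> b <= a -> quasi_clique a b s1 ->
  {in s1, forall x, adj v x} ->
  {in s2, forall y x, x \in v :: s1 ++ s2 -> adj x y = false} ->
  quasi_clique a.+1 b.+1 (v :: s1 ++ s2).
Proof.
move=> sz ba qs vs1 s2x x0 i [//|j].
rewrite ltnS /= !ltnS size_cat sz => /andP[ij ljs].
have [ja|aj] := leqP j a; last first.
  rewrite (s2x (nth x0 (s1 ++ s2) j)).
  - by apply/esym/norP; split; lia.
  - by rewrite nth_cat sz ltnNge aj /= mem_nth // ltn_subLR.
  rewrite -[i]/(i) -cat_cons; apply: (@mem_nth _ x0 (v :: s1 ++ s2)) => /=.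
  by rewrite size_cat sz; lia.
rewrite nth_cat sz ltnS ja; case: i ij => [|i] /= ij.
  by rewrite vs1 ?mem_nth ?sz //; lia.
rewrite nth_cat sz ifT; last by lia.
by rewrite qs ?sz; [rewrite eqSS | lia].
Qed.

Lemma quasi_clique_full (G : sgraph) (a : nat) (s : seq G) :
  quasi_clique a a s -> quasi_clique a.+1 0 s.
Proof. by move=> qs x0 i j ij; rewrite qs //; lia. Qed.


(* [bin a 2 + b] edges on a threshold graph: the neighbourhood of a dominating
   vertex has at most [bin (a-1) 2 + (b-1)] edges when it has at least [a]
   vertices; otherwise the whole core lies within a clique on [a] vertices. *)
Lemma threshold_tri (G : sgraph) (W : {set G}) (a b : nat) :
  threshold G -> b <= a -> arcs W <= 2 * ('C(a, 2) + b) ->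
  tri W <= 6 * ('C(a, 3) + 'C(b, 2)) /\
  (arcs W = 2 * ('C(a, 2) + b) -> tri W = 6 * ('C(a, 3) + 'C(b, 2)) ->
   exists s : seq G, [/\ uniq s, s =i W & quasi_clique a b s]).
Proof.
move=> thr; have [k leWk] := ubnP #|W|.
elim: k => // k IH in W leWk a b *.
have [arc0|] := posnP (arcs W).
  have indep x y : x \in W -> y \in W -> adj x y = false.
    move=> xW yW; apply/eqP; rewrite -[_ == _]negbK; apply/negP => xy.
    have: arcs W >= adj x y.
      by rewrite /arcs (bigD1 x) //= (bigD1 y) //= -addnA leq_addr.
    by rewrite arc0; case: adj xy.
  have -> : tri W = 0.
    by rewrite (@tri_core _ set0) ?sub0set /tri ?big_set0 // => x y xW yW;
      rewrite indep.
  move=> ba _; split=> // ab0 _; exists (enum W); split; first exact: enum_uniq.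
    by move=> x; rewrite mem_enum.
  move=> x0 i j /andP[ij js]; have is' := ltn_trans ij js.
  rewrite indep; [|by rewrite -mem_enum mem_nth|by rewrite -mem_enum mem_nth].
  (* With no arcs, equality gives ['C(a, 2) + b = 0], so the pattern to be matched has no edge. *)
  have a1 : a <= 1 by case: (a) ab0 => [|[|a']] //; rewrite binS bin1; lia.
  by apply/esym/norP; split; lia.
move=> arc_pos.
(* A clique on [a.+1] vertices is also one on [a] vertices plus a vertex joined to all of them, so
   [(a.+1, 0)] is traded for [(a, a)]. *)
wlog b0 : a b / 0 < b.
  move=> hw; case: b => [|b]; last exact: hw.
  case: a => [|a] _; first by rewrite bin0n; lia.
  rewrite addn0 => arcW.
  have E2 : 'C(a.+1, 2) = 'C(a, 2) + a by rewrite binS bin1.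
  have E3 : 'C(a.+1, 3) = 'C(a, 3) + 'C(a, 2) by rewrite binS.
  rewrite bin0n addn0 E2 E3; case: (posnP a) => a0.
    by move: arcW; rewrite a0 /= muln0; lia.
  have [] := hw a a a0 (leqnn a); first by rewrite -E2.
  move=> triW eqW; split=> // eqa eqt.
  have [s [us sW qs]] := eqW eqa eqt.
  by exists s; split=> //; apply: quasi_clique_full.
move=> ba arcW.
have [v0 v0W] : exists v0, v0 \in W.
  by apply/set0Pn; apply: contraTneq arc_pos => ->; rewrite /arcs big_set0.
have [v vW dom] := threshold_dominating thr v0W.
set R := nbr v W in dom.
have vR : v \notin R by rewrite inE adj_irr andbF.
have RW : R \subset W by apply/subsetP => x; rewrite inE => /andP[].
have nbrR : nbr v R = R.
  by apply/setP => x; rewrite !inE -andbA andbb.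
have vRW : v |: R \subset W by rewrite subUset sub1set vW.
have arcWE : arcs W = arcs R + 2 * #|R|.
  by rewrite (arcs_core vRW dom) (arcsU1 vR) nbrR.
have triWE : tri W = tri R + 3 * arcs R.
  by rewrite (tri_core vRW dom) (triU1 vR) nbrR.
have cardR : #|R| < k.
  rewrite ltnS in leWk; apply: leq_trans leWk; apply: proper_card.
  by apply/properP; split=> //; exists v.
have Ea2 : 'C(a, 2) = 'C(a.-1, 2) + a.-1.
  by case: (a) b0 ba => [|a'] /=; [lia | rewrite binS bin1].
have Ea3 : 'C(a, 3) = 'C(a.-1, 3) + 'C(a.-1, 2).
  by case: (a) b0 ba => [|a'] /=; [lia | rewrite binS].
have Eb2 : 'C(b, 2) = 'C(b.-1, 2) + b.-1.
  by case: (b) b0 => [|b'] //= _; rewrite binS bin1.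
have [aR|Ra] := leqP a #|R|.
  (* Removing at least [a] edges at [v] leaves at most ['C(a.-1, 2) + b.-1]. Equality of triangles
     then makes this bound tight, whence [#|R| = a]. *)
  have [] := IH R cardR a.-1 b.-1; [lia|lia|].
  move=> triR eqR; split; first by lia.
  move=> eqa eqt; have eqRa : #|R| = a by lia.
  have [s [us sR qs]] : exists s : seq G,
    [/\ uniq s, s =i R & quasi_clique a.-1 b.-1 s] by apply: eqR; lia.
  exists (v :: s ++ enum (W :\: (v |: R))).
  have mem2 x : (x \in enum (W :\: (v |: R))) = (x \notin v |: R) && (x \in W).
    by rewrite mem_enum inE.
  split.
  - rewrite /= mem_cat sR (negbTE vR) mem2 !inE eqxx /= cat_uniq us.
    rewrite enum_uniq andbT.
    by apply/hasPn => x; rewrite mem2 sR !inE => /andP[/norP[]].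
  - move=> x; rewrite inE mem_cat sR mem2 !inE.
    have [->|xv] /= := eqVneq x v; rewrite ?vW //.
    by case: (x \in W); case: adj.
  - have szs : size s = a by rewrite -eqRa -(card_uniqP us); apply: eq_card.
    rewrite -(prednK b0) -(prednK (leq_trans b0 ba)).
    apply: quasi_clique_cons => //; [lia|lia| |].
      by move=> x; rewrite sR inE => /andP[].
    move=> y; rewrite mem2 => /andP[yR yW] x xs; apply/negP => xy.
    case/negP: yR; apply: (dom y x) => //; last by rewrite adj_sym.
    by move: xs; rewrite inE mem_cat sR mem2 =>
      /or3P[/eqP->|/(subsetP RW)|/andP[]].
(* All edges now lie on [#|R|.+1 <= a] vertices: at most ['C(a, 2)] edges, so with [0 < b] the
   equality case is void. *)
have arcR := arcs_le R.
have [] := IH R cardR #|R| 0; [lia|lia|rewrite bin0n addn0 => triR _].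
have E2 : 'C(#|R|.+1, 2) = 'C(#|R|, 2) + #|R| by rewrite binS bin1.
have E3 : 'C(#|R|.+1, 3) = 'C(#|R|, 3) + 'C(#|R|, 2) by rewrite binS.
have := leq_bin2l 2 Ra; have := leq_bin2l 3 Ra; split; first lia.
by move=> eqa; lia.
Qed.

(** * The extremal graph *)

Lemma clique_count (G : sgraph) (W : {set G}) :
  {in W &, forall x y, x != y -> adj x y} ->
  arcs W = 2 * 'C(#|W|, 2) /\ tri W = 6 * 'C(#|W|, 3).
Proof.
have [k leWk] := ubnP #|W|; elim: k => // k IH in W leWk *.
have [->|[v vW]] := set_0Vmem W; first by rewrite /arcs /tri !big_set0 cards0.
rewrite -(setD1K vW); set R := W :\ v => cl.
have vR : v \notin R by rewrite !inE eqxx.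
have [|x y xR yR xy|arcR triR] := IH R.
- by move: leWk; rewrite (cardsD1 v) vW.
- by apply: cl => //; rewrite inE ?xR ?yR orbT.
have nbrR : nbr v R = R.
  apply/setP => x; rewrite inE; apply: andb_idr => xR.
  by apply: cl; rewrite ?setU11 // ?setU1r //; apply: contraNneq vR => ->.
rewrite (arcsU1 vR) (triU1 vR) nbrR cardsU1 vR add1n !binS bin1.
by split; lia.
Qed.

(** The added vertex is split off; its neighbourhood is itself a clique, on [t] vertices. *)
Lemma Krt_counts (r t : nat) : t <= r ->
  arcs [set: Krt r t] = 2 * ('C(r, 2) + t) /\
  tri [set: Krt r t] = 6 * ('C(r, 3) + 'C(t, 2)).
Proof.
move=> tr; pose R : {set Krt r t} := [set Some i | i in [set: 'I_r]].
pose A : {set Krt r t} := [set Some i | i in [set i : 'I_r | i < t]].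
have clR (B : {set 'I_r}) : {in [set Some i | i in B] : {set Krt r t} &,
    forall x y, x != y -> adj x y}.
  by move=> _ _ /imsetP[i _ ->] /imsetP[j _ ->].
have SI : injective (@Some 'I_r) by move=> i j [].
have cardR : #|R| = r by rewrite card_imset // cardsT card_ord.
have cardA : #|A| = t.
  rewrite card_imset //.
  have <- : [set widen_ord tr i | i : 'I_t] = [set i : 'I_r | i < t].
    apply/setP => i; rewrite inE; apply/imsetP/idP => [[j _ ->] //=|it].
    by exists (Ordinal it) => //; apply: val_inj.
  by rewrite card_imset ?card_ord // => i j /(congr1 val)/= /val_inj.
have NR : None \notin R by apply/imsetP => -[].
have -> : [set: Krt r t] = None |: R.
  by apply/setP => -[i|]; rewrite !inE // (imset_f Some) ?inE.
have nbrR : nbr (None : Krt r t) R = A.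
  apply/setP => -[i|]; rewrite !inE /=; last first.
    by rewrite andbF; apply/esym/imsetP => -[].
  by rewrite !(mem_imset _ _ SI) !inE.
have [arcR triR] := clique_count (clR setT).
have [arcA _] := clique_count (clR [set i : 'I_r | i < t]).
rewrite (arcsU1 NR) (triU1 NR) nbrR cardA.
move: arcR triR arcA; rewrite -/A -/R cardA.
by rewrite cardR => -> -> ->; split; lia.
Qed.

Lemma arcs_add_pendants (G : sgraph) (v : G) (k : nat) :
  arcs [set: add_pendants v k] = arcs [set: G] + 2 * k.
Proof.
have deg : \sum_(x : G) (x == v : nat) = 1.
  by rewrite -big_mkcond /= (big_pred1 v).
rewrite !arcsT !big_sumType /=.
under eq_bigr do rewrite big_sumType /=.
under [X in _ + X]eq_bigr do rewrite big_sumType /=.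
rewrite !big_split /= -addnA; congr (_ + _).
have -> : \sum_(x : G) \sum_(i < k) ((x == v) : nat) = k.
  by rewrite exchange_big /= (eq_bigr (fun=> 1)) // big_const_ord
    iter_addn_0 mul1n.
have -> : \sum_(i < k) \sum_(x : G) ((x == v) : nat) = k.
  transitivity (\sum_(i < k) 1); first by apply: eq_bigr.
  by rewrite big_const_ord iter_addn_0 mul1n.
rewrite big1; first by lia.
by move=> i _; rewrite big1.
Qed.

Lemma tri_add_pendants (G : sgraph) (v : G) (k : nat) :
  tri [set: G] <= tri [set: add_pendants v k].
Proof.
rewrite !triT big_sumType /= (leq_trans _ (leq_addr _ _)) //.
apply: leq_sum => x _; rewrite big_sumType /= (leq_trans _ (leq_addr _ _)) //.
apply: leq_sum => y _; rewrite big_sumType /= (leq_trans _ (leq_addr _ _)) //.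
Qed.

Lemma isomorphic_sym (G H : sgraph) : isomorphic G H -> isomorphic H G.
Proof.
case=> f [g fK gK] fA; exists g; first by exists f.
by move=> x y; rewrite -fA !gK.
Qed.

(** Vertices at equal positions correspond; comparing increasing pairs is enough by symmetry and
    irreflexivity. *)
Lemma isomorphic_index (G H : sgraph) (idx : H -> nat) (s : seq G)
    (e : rel nat) :
  uniq s -> s =i [set: G] -> #|G| = #|H| -> injective idx ->
  (forall x, idx x < #|H|) ->
  (forall x y, idx x < idx y -> adj x y = e (idx x) (idx y)) ->
  (forall x0 i j, i < j < #|G| -> adj (nth x0 s i) (nth x0 s j) = e i j) ->
  isomorphic G H.
Proof.
move=> us sG cGH idx_inj idx_lt adjH adjG; apply: isomorphic_sym.
have sz : size s = #|G|.
  by rewrite -(card_uniqP us) -cardsT; apply: eq_card.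
case: s us sG sz adjG => [|x0 s'] us sG sz adjG.
  have H0 (x : H) : False by have := idx_lt x; rewrite -cGH -sz.
  have G0 (x : G) : False by have := sG x; rewrite in_setT.
  exists (fun x => False_rect G (H0 x)) => [|x]; last by case: (H0 x).
  by exists (fun x => False_rect H (G0 x)) => x; [case: (H0 x) | case: (G0 x)].
set s := x0 :: s' in us sG sz adjG.
pose f x := nth x0 s (idx x).
have f_inj : injective f.
  move=> x y /eqP; rewrite nth_uniq ?sz ?cGH // => /eqP; exact: idx_inj.
exists f; first by apply: inj_card_bij => //; rewrite cGH.
move=> x y; rewrite /f; case: (ltngtP (idx x) (idx y)) => [lt|lt|/idx_inj->].
- by rewrite adjG ?lt ?cGH ?idx_lt // adjH.
- by rewrite adj_sym adjG ?lt ?cGH ?idx_lt // [RHS]adj_sym adjH.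
- by rewrite !adj_irr.
Qed.

Lemma is_rt_bounds (m n r t : nat) : 0 < m -> 0 < n -> n - 1 <= m <= 'C(n, 2) ->
  is_rt m n r t -> [/\ 0 < t, t <= r, r < n & m = 'C(r, 2) + t + (n - r - 1)].
Proof.
move=> m0 n0 /andP[nm mn] [r0 t0 D ge0 eq1].
have Er : 'C(r, 2) = 'C(r.-1, 2) + r.-1.
  by case: (r) r0 => // r' _; rewrite binS bin1.
have En : 'C(n, 2) = 'C(n.-1, 2) + n.-1.
  by case: (n) n0 => // n' _; rewrite binS bin1.
have [lt_mn | le_nm] := ltnP m n.
  have [t1 r1] : t = 1 /\ r = 1 by apply: eq1; lia.
  by rewrite t1 r1 /= in D Er *; split; lia.
have /andP[t2 tr] : 2 <= t <= r by apply: ge0; lia.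
have rn : r < n.
  rewrite ltnNge; apply/negP => nr.
  (* If [n <= r], then [m] is at least ['C(n.-1, 2) + n], one more than ['C(n, 2)]. *)
  have : 'C(n.-1, 2) <= 'C(r.-1, 2) by apply: leq_bin2l; lia.
  by lia.
by split=> //; lia.
Qed.

Section Star.
Variables (r t k : nat) (r0 : 0 < r).
Let v : Krt r t := Some (Ordinal r0).

Lemma Krt_center (t0 : 0 < t) (x : Krt r t) : adj v x = (x != v).
Proof. by case: x => [i|] /=; rewrite ?inE // eq_sym. Qed.

Lemma deg_Krt_center : 0 < t -> deg v = r.
Proof.
move=> t0; rewrite /deg.
have -> : [set w | adj v w] = [set~ v].
  by apply/setP => x; rewrite !inE Krt_center.
by rewrite cardsC1 card_option card_ord.
Qed.

Lemma card_Krt_pendants : #|add_pendants v k| = r.+1 + k.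
Proof. by rewrite card_sum card_option !card_ord. Qed.

Lemma connected_Krt_pendants : 0 < t -> connected (add_pendants v k).
Proof.
move=> t0; pose e := @adj (add_pendants v k).
have eC : connect_sym e by apply: sym_connect_sym; apply: adj_sym.
have toc x : connect e (inl v) x.
  case: x => [x|i]; last by rewrite connect1 //= eqxx.
  have [-> //|xv] := eqVneq x v.
  by apply: connect1; rewrite -[e _ _]/(adj v x) Krt_center.
by move=> x y; apply: connect_trans (toc y); rewrite -/e eC.
Qed.

(** The centre [v] gets 0, and pendants come after the added vertex, to match a dominating vertex
    followed by a [quasi_clique] list. *)
Definition Krt_index (x : add_pendants v k) : nat :=
  match x with
  | inl (Some i) => i
  | inl None => r
  | inr j => r.+1 + j
  end.

Lemma Krt_index_inj : injective Krt_index.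
Proof.
move=> [[i|]|i] [[j|]|j] //= eij; try by have := ltn_ord i; lia.
- by move/val_inj: eij => ->.
- by have := ltn_ord j; lia.
- by lia.
- by have := ltn_ord j; lia.
- by have /val_inj-> : i = j :> nat by lia.
Qed.

Lemma Krt_index_lt (x : add_pendants v k) : Krt_index x < r.+1 + k.
Proof. by case: x => [[i|]|i] /=; try have := ltn_ord i; lia. Qed.

Lemma Krt_index_adj (x y : add_pendants v k) : 0 < t -> t <= r ->
  Krt_index x < Krt_index y -> adj x y =
    (Krt_index y < r) || (Krt_index y == r) && (Krt_index x < t) ||
    (Krt_index x == 0).
Proof.
move=> t0 tr; case: x y => [[i|]|i] [[j|]|j] //=;
  rewrite ?ltnn ?eqxx ?inE ?orbF /=.
- by move=> ij; rewrite ltn_ord /=; apply: contraTneq ij => ->; rewrite ltnn.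
- by move=> _; lia.
- by move=> _; rewrite -[Some i == v]/(val i == 0) /=; lia.
- by have := ltn_ord j; lia.
- by [].
- by move=> _; rewrite -[None == v]/false; lia.
- by have := ltn_ord j; lia.
- by lia.
- by lia.
Qed.
End Star.

Theorem theorem3p1 (m n : nat) (hm : 0 < m) (hn : 0 < n)
    (hnm : n - 1 <= m <= 'C(n, 2))
    (r t : nat) (hrt : is_rt m n r t)
    (Gs : sgraph) (hGs : last_in_S_order m n Gs) :
  exists v : Krt r t,
    deg v = r /\ isomorphic Gs (add_pendants v (n - r - 1)).
Proof.
have [t0 tr rn Dm] := is_rt_bounds hm hn hnm hrt.
have r0 := leq_trans t0 tr.
exists (Some (Ordinal r0)); split; first exact: deg_Krt_center.
set v0 : Krt r t := Some _; set k := n - r - 1 in Dm *.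
have [arcK triK] := Krt_counts tr.
have nE : r.+1 + k = n by lia.
have conn0 : conn_graph m n (add_pendants v0 k).
  split; first exact: connected_Krt_pendants.
    by apply: double_inj; rewrite -arcs_edges arcs_add_pendants arcK -mul2n;
      lia.
  by rewrite card_Krt_pendants.
have [triG _] := last_lexi hGs conn0.
have {triG} triG := leq_trans (tri_add_pendants v0 k) triG.
have [[cG mG nG] _] := hGs.
have thr := last_is_threshold hGs.
have /card_gt0P[x0 _] : 0 < #|Gs| by rewrite nG.
have [v _ dom] := threshold_dominating thr (in_setT x0).
(* Connectedness leaves no isolated vertex, so the dominating vertex is adjacent to all others. *)
have adjv x : x != v -> adj v x.
  move=> xv; case/connectP: (cG x v) => -[|y p] /=.
    by move=> _ vx; rewrite vx eqxx in xv.
  case/andP=> xy _ _; have := dom x y (in_setT _) (in_setT _) xy.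
  by rewrite !inE (negbTE xv).
set R := [set~ v].
have vR : v \notin R by rewrite !inE eqxx.
have nbrR : nbr v R = R.
  by apply/setP => x; rewrite !inE; apply: andb_idr => /adjv.
have VE : [set: Gs] = v |: R by rewrite setUCr.
have cardR : #|R| = n.-1 by rewrite cardsC1 nG.
have arcG : arcs [set: Gs] = arcs R + 2 * #|R| by rewrite VE arcsU1 // nbrR.
have triGE : tri [set: Gs] = tri R + 3 * arcs R by rewrite VE triU1 // nbrR.
have Er2 : 'C(r, 2) = 'C(r.-1, 2) + r.-1.
  by rewrite -{1}(prednK r0) binS bin1.
have Er3 : 'C(r, 3) = 'C(r.-1, 3) + 'C(r.-1, 2).
  by rewrite -{1}(prednK r0) binS.
have Et2 : 'C(t, 2) = 'C(t.-1, 2) + t.-1.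
  by rewrite -{1}(prednK t0) binS bin1.
have arcR : arcs R = 2 * ('C(r.-1, 2) + t.-1).
  by move: arcG; rewrite arcs_edges mG -mul2n cardR; lia.
(* The candidate bounds the triangles of [Gs] from below; after subtracting those through [v], this
   meets the upper bound on [R], so the equality case applies. *)
have [||triR] := threshold_tri (W := R) (a := r.-1) (b := t.-1) thr; [lia|lia|].
case=> //; first by lia.
move=> s [us sR qs].
have szs : size s = n.-1 by rewrite -cardR -(card_uniqP us); apply: eq_card.
(* Putting [v] in front turns [(r.-1, t.-1)] into [(r, t)]; the isolated vertices of [R] become the
   pendants, whence the clause [i == 0]. *)
apply: (@isomorphic_index _ _ (@Krt_index r t k r0) (v :: s)
  (fun i j => (j < r) || (j == r) && (i < t) || (i == 0))).
- by rewrite /= us sR vR.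
- by move=> x; rewrite VE !inE sR !inE.
- by rewrite card_Krt_pendants nG.
- exact: Krt_index_inj.
- by move=> x; rewrite card_Krt_pendants Krt_index_lt.
- by move=> x y; apply: Krt_index_adj.
move=> y0 i j; rewrite nG => /andP[ij jn].
case: j ij jn => // j; case: i => [_|i ij] jn /=.
  have jR : nth y0 s j \in R by rewrite -sR mem_nth // szs; lia.
  by rewrite orbT adjv //; move: jR; rewrite !inE.
rewrite qs; last by rewrite szs; lia.
by lia.
Qed.
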